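(* For each integer $a\ge 0$ let $I_a=\{1,3,5,\ldots,2a+1\}$ (so $s(I_a)=a$). For every nonnegative integer $i$ there exists a unique polynomial $P_i(t)\in\mathbb{Q}[t]$ of degree at most $i$ such that $P_i(a)=\frac{C_{a-i}(I_a)}{C_a(I_a)}$ for all integers $a\ge i$.
   Context: Partitions are drawn as Young diagrams $\mathbb{D}(\lambda)$ in English notation; $c_{i,j}$ is the cell in row $i$, column $j$. The hook length $h_\lambda(c)$ is the number of cells of $\mathbb{D}(\lambda)$ weakly right of $c$ in its row or weakly below $c$ in its column (counting $c$ once). For $\mu\subseteq\lambda$, an excited diagram of $\lambda/\mu$ is a subset of $\mathbb{D}(\lambda)$ obtained from $\mathbb{D}(\mu)$ by repeatedly replacing a cell $c_{i,j}\in D$ by $c_{i+1,j+1}$, allowed iff $c_{i+1,j+1}\in\mathbb{D}(\lambda)$ and none of $c_{i,j+1},c_{i+1,j},c_{i+1,j+1}$ lies in $D$; $\mathbb{E}(\lambda/\mu)$ is their set. A ribbon with $n$ cells is read from its lower-left to its upper-right cell, each successive cell directly right of or directly above the previous; it corresponds to the set of $i\in\{1,\ldots,n-1\}$ with cell $i$ directly below cell $i+1$. A descent set is a non-empty finite set $I$ of positive integers; $\lambda^I$ is the unique partition with $\lambda^I_1=\lambda^I_2$ such that the cells $c_{i,j}\in\mathbb{D}(\lambda^I)$ with fewer than three of $c_{i,j+1},c_{i+1,j},c_{i+1,j+1}$ in $\mathbb{D}(\lambda^I)$ form a ribbon corresponding to $I$; this ribbon is $\mathbb{D}(\lambda^I)\setminus\mathbb{D}(\mu^I)$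 for a partition $\mu^I$. Let $s(I)=\lambda^I_1-1$. Naruse-Newton coefficients: every excited diagram of $\lambda^I/\mu^I$ meets row 1 in $\{c_{1,1},\ldots,c_{1,r}\}$, $0\le r\le s$; for $0\le j\le s(I)$, $C_j(I)=\sum_D\prod_{c\in D,\,c\notin\text{row }1}h_{\lambda^I}(c)$, summed over $D\in\mathbb{E}(\lambda^I/\mu^I)$ with exactly $s-j$ cells in row 1. *)

(* Defs.v *)
From Stdlib Require Import ClassicalEpsilon.
From mathcomp Require Import all_boot all_order all_algebra.
Set Implicit Arguments. Unset Strict Implicit. Unset Printing Implicit Defensive.

(* Cells are pairs (row, column) of naturals, 1-indexed, English notation. *)

Definition is_partition (lam : seq nat) : bool :=
  sorted geq lam && all (fun x => 0 < x) lam.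

Definition in_diag (lam : seq nat) (p : nat * nat) : bool :=
  (0 < p.1 <= size lam) && (0 < p.2 <= nth 0 lam p.1.-1).

Definition outer_cell (lam : seq nat) (p : nat * nat) : bool :=
  in_diag lam p &&
  (in_diag lam (p.1, p.2.+1) + in_diag lam (p.1.+1, p.2)
     + in_diag lam (p.1.+1, p.2.+1) < 3).

(* A ribbon listed from its lower-left to its upper-right cell: each successive
   cell is directly right of or directly above the previous one. *)
Definition is_ribbon_listing (s : seq (nat * nat)) : Prop :=
  uniq s /\
  forall k, k.+1 < size s ->
    let c := nth (0, 0) s k in let c' := nth (0, 0) s k.+1 in
    (c' = (c.1, c.2.+1)) \/ (c.1 = c'.1.+1 /\ c'.2 = c.2).

Definition directly_below (c c' : nat * nat) : Prop :=
  c.1 = c'.1.+1 /\ c.2 = c'.2.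

(* The ribbon listed by s (with n = size s cells, cell i = nth s (i-1))
   corresponds to the set I (a finite set of naturals, given as a seq). *)
Definition ribbon_corresponds (s : seq (nat * nat)) (I : seq nat) : Prop :=
  (forall i, i \in I -> 0 < i < size s) /\
  (forall i, 0 < i < size s ->
     (i \in I <-> directly_below (nth (0, 0) s i.-1) (nth (0, 0) s i))).

Definition is_lambdaI (I : seq nat) (lam : seq nat) : Prop :=
  is_partition lam /\ nth 0 lam 0 = nth 0 lam 1 /\
  exists s, is_ribbon_listing s /\ ribbon_corresponds s I /\
            (forall c, outer_cell lam c <-> c \in s).

(* lambda^I: "the unique partition" with that property. *)
Definition lambdaI (I : seq nat) : seq nat :=
  @epsilon (seq nat) (inhabits [::]) (is_lambdaI I).

Definition is_muI (I : seq nat) (mu : seq nat) : Prop :=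
  is_partition mu /\ (forall c, in_diag mu c -> in_diag (lambdaI I) c) /\
  (forall c, (in_diag (lambdaI I) c && ~~ in_diag mu c) = outer_cell (lambdaI I) c).

Definition muI (I : seq nat) : seq nat :=
  @epsilon (seq nat) (inhabits [::]) (is_muI I).

Definition sI (I : seq nat) : nat := (nth 0 (lambdaI I) 0).-1.

Definition hook (lam : seq nat) (p : nat * nat) : nat :=
  (nth 0 lam p.1.-1 - p.2) + (count (fun r => p.2 <= r) lam - p.1) + 1.

(* A finite type of cells large enough to contain D(lam). *)
Definition bnd (lam : seq nat) : nat := (size lam + head 0 lam).+1.
Definition cellT (lam : seq nat) : finType := ('I_(bnd lam) * 'I_(bnd lam))%type.
Definition natc (M : nat) (c : 'I_M * 'I_M) : nat * nat := (val c.1, val c.2).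
Definition memc (M : nat) (D : {set 'I_M * 'I_M}) (p : nat * nat) : bool :=
  [exists d in D, natc d == p].

Definition exc_move (lam : seq nat) : rel {set cellT lam} := fun D D' =>
  [exists c in D,
    [&& in_diag lam ((val c.1).+1, (val c.2).+1),
        ~~ memc D (val c.1, (val c.2).+1),
        ~~ memc D ((val c.1).+1, val c.2),
        ~~ memc D ((val c.1).+1, (val c.2).+1) &
        [forall d, (d \in D') ==
           ((natc d == ((val c.1).+1, (val c.2).+1)) || ((d \in D) && (d != c)))]]].

Definition diagT (lam mu : seq nat) : {set cellT lam} :=
  [set d | in_diag mu (natc d)].

Definition excited (lam mu : seq nat) : {set {set cellT lam}} :=
  [set D | connect (@exc_move lam) (diagT lam mu) D].

Definition row1_count (lam : seq nat) (D : {set cellT lam}) : nat :=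
  #|[set d in D | val d.1 == 1]|.

Definition NNcoef (j : nat) (I : seq nat) : nat :=
  let lam := lambdaI I in
  \sum_(D in excited lam (muI I) | row1_count D == sI I - j)
     \prod_(d in D | val d.1 != 1) hook lam (natc d).

Definition Iodd (a : nat) : seq nat := [seq (2 * k).+1 | k <- iota 0 a.+1].

(* Main.v *)
Require Import Defs.
From Stdlib Require Import ClassicalEpsilon.
From mathcomp Require Import all_boot all_order all_algebra.
From mathcomp Require Import zify ring.
Import GRing.Theory Num.Theory.

(* For [I_a] the partition is [(a+1, a+1, a, ..., 1)], and an excited diagram is
   the complement of a lattice path from the lower-left to the upper-right cell
   of the rim.  Below row 1 the hook of a cell depends only on its distance to
   the boundary, so splitting off the last step of a path gives, for the ratios
   [R i a = C_(a-i) / C_a],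
     [(2 (a-i) + 1) R (i+1) (a+1) = R i (a+1) + (2 a + 3) R (i+1) a]
   with [R 0 a = 1] and [R (i+1) i = 0].  In [R (i+1)] this is a first-order
   difference equation whose homogeneous solution is the polynomial
   [(2t+1) (2t-1) ... (2t+1-2i)]; expanding in such products solves it by a
   polynomial of degree at most [i+1]. *)

(** * Weighted chains and their recurrence *)

(** Below row 1, the cell in column [c] of the row of length [m] has hook length [2 (m - c) + 1];
    this is the hook product over the cells of that row missed by the path. *)
Definition row_weight (m x y : nat) : nat :=
  \prod_(1 <= c < m.+1 | ~~ (x <= c <= y)) (2 * (m - c)).+1.

(* [chains a.+1 y] lists the columns in which such a path leaves the rows
   [2, 3, ..., a+2], starting with [y], followed by the column 1 in which it
   starts. *)
Fixpoint chains (m y : nat) : seq (seq nat) :=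
  if m is m'.+1 then
    if y <= m then [seq y :: l | x <- iota 1 y, l <- chains m' x] else [::]
  else if y == 1 then [:: [:: 1]] else [::].

Definition chain_weight (m : nat) (l : seq nat) : nat :=
  \prod_(k < m) row_weight (m - k) (nth 0 l k.+1) (nth 0 l k).

Definition chain_sum (m y : nat) : nat :=
  \sum_(l <- chains m y) chain_weight m l.

Lemma chains_head m y l : l \in chains m y -> exists l', l = y :: l'.
Proof.
case: m => [|m] /=; case: ifP => // y1.
  by rewrite inE => /eqP ->; exists [::]; rewrite (eqP y1).
by case/allpairsPdep => x [l' [_ _ ->]]; exists l'.
Qed.

Lemma chains_uniq m y : uniq (chains m y).
Proof.
elim: m y => [|m IHm] y /=; case: ifP => // _.
apply: allpairs_uniq_dep => [|x _|]; [exact: iota_uniq|exact: IHm|].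
move=> _ _ /allpairsPdep[x [l [_ lx ->]]] /allpairsPdep[x' [l' [_ lx' ->]]].
case=> ll'; rewrite -ll' in lx' *.
have [t lt] := chains_head _ _ _ lx; have [t' lt'] := chains_head _ _ _ lx'.
by move: lt'; rewrite lt => -[->].
Qed.

Lemma mem_chains m y l :
  reflect [/\ size l = m.+1, nth 0 l 0 = y, nth 0 l m = 1 &
             forall k, k < m ->
               (1 <= nth 0 l k.+1 <= nth 0 l k) && (nth 0 l k <= m - k)]
    (l \in chains m y).
Proof.
apply: (iffP idP) => [|[]].
  elim: m y l => [|m IHm] y l /=; case: ifP => // ym.
    by rewrite inE => /eqP ->; rewrite (eqP ym).
  case/allpairsPdep => x [l' [xy l'x ->]]; have [sl hl ll nl] := IHm _ _ l'x.
  split=> //=; first by rewrite sl.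
  case=> [|k] km /=; last exact: nl.
  by move: xy; rewrite hl mem_iota subn0; lia.
elim: m y l => [|m IHm] y [|h l] //= [sl] <- ll nl.
  by move: sl ll; case: l {nl} => // _ /= ->.
have := nl 0 isT; rewrite /= => h0; rewrite ifT; last by lia.
apply/allpairsPdep; exists (nth 0 l 0), l; split=> //.
  by rewrite mem_iota; lia.
by apply: IHm => // k km; have := nl k.+1 km.
Qed.

Lemma chain_sumS m y : chain_sum m.+1 y =
  if y <= m.+1 then \sum_(1 <= x < y.+1) chain_sum m x * row_weight m.+1 x y
  else 0.
Proof.
rewrite /chain_sum /=; case: ifP => _; last by rewrite big_nil.
rewrite big_allpairs_dep /index_iota subn1 /=; apply: eq_bigr => x _.
rewrite big_distrl; apply: eq_big_seq => l /chains_head[l' ->].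
by rewrite /chain_weight big_ord_recl /= mulnC.
Qed.

(** The hook in column [y.+1] is the factor lost when the interval grows to include it. For
    [x = y.+1] the smaller interval is empty. *)
Lemma row_weightS m x y : x <= y.+1 <= m ->
  row_weight m x y.+1 * (2 * (m - y.+1)).+1 = row_weight m x y.
Proof.
move=> xym; rewrite /row_weight !(big_mkcond (fun c => ~~ _)) mulnC.
have yr : y.+1 \in index_iota 1 m.+1 by rewrite mem_index_iota; lia.
rewrite !(bigD1_seq y.+1 yr (iota_uniq _ _)) /=.
rewrite ifF ?mul1n ?ifT; try lia; congr (_ * _); apply: eq_bigr => c cy.
by congr (if _ then _ else _); lia.
Qed.

Lemma row_weight_empty m x y : y < x -> row_weight m x y = row_weight m 1 0.
Proof. by move=> yx; apply: eq_bigl => c; lia. Qed.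

Lemma row_weight_gt0 m x y : 0 < row_weight m x y.
Proof. exact: prodn_cond_gt0. Qed.

(** Multiplying by the hook in column [y.+1] takes that column off the path: the terms [x <= y] of
    [chain_sumS] become those for [y], and in the term [x = y.+1] the interval becomes empty,
    leaving the full row product. *)
Lemma chain_sum_recr m y : y <= m ->
  chain_sum m.+1 y.+1 * (2 * (m - y)).+1 =
  chain_sum m.+1 y + chain_sum m y.+1 * row_weight m.+1 1 0.
Proof.
move=> ym; rewrite !chain_sumS !ifT; try lia.
rewrite big_distrl big_nat_recr //=; congr (_ + _).
  apply: eq_big_nat => x xy; rewrite -mulnA -subSS row_weightS //; lia.
by rewrite -mulnA -subSS row_weightS ?row_weight_empty //; lia.
Qed.

Lemma chain_sum_gt m y : maxn m 1 < y -> chain_sum m y = 0.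
Proof.
rewrite gtn_max => /andP[my y1]; rewrite /chain_sum.
case: m my => [|m] my /=; rewrite ifF ?big_nil //; lia.
Qed.

Lemma chain_sum0 m : chain_sum m.+1 0 = 0.
Proof. by rewrite chain_sumS big_geq. Qed.

(** Makes the denominators [C_a] invertible. *)
Lemma chain_sum1_gt0 m : 0 < chain_sum m 1.
Proof.
case: m => [|m].
  by rewrite /chain_sum /= big_seq1 /chain_weight big_ord0.
elim: m => [|m IHm].
  rewrite chain_sumS big_nat1 /chain_sum big_seq1 /chain_weight big_ord0.
  by rewrite mul1n row_weight_gt0.
by rewrite chain_sumS big_nat1 muln_gt0 IHm row_weight_gt0.
Qed.

(** * The partition [(a+1, a+1, a, ..., 1)], its rim and its hooks *)

Definition shape (a : nat) : seq nat := a.+1 :: mkseq (subn a.+1) a.+1.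

Lemma size_shape a : size (shape a) = a.+2.
Proof. by rewrite /shape; cbn [size]; rewrite size_mkseq. Qed.

Lemma nth_shapeS a k : nth 0 (shape a) k.+1 = a.+1 - k.
Proof.
rewrite /shape; cbn [nth]; have [ka|ak] := ltnP k a.+1; first by rewrite nth_mkseq.
by rewrite nth_default ?size_mkseq //; lia.
Qed.

Lemma in_diag_shape a r c :
  in_diag (shape a) (r, c) = [&& 0 < r, 0 < c <= a.+1 & r + c <= a + 3].
Proof.
rewrite /in_diag size_shape; case: r => [|[|r]]; cbn [fst snd predn] => //.
  by rewrite /=; lia.
by rewrite nth_shapeS; lia.
Qed.

Lemma outer_cell_shape a r c : outer_cell (shape a) (r, c) =
  in_diag (shape a) (r, c) && ((c == a.+1) || (a + 2 <= r + c)).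
Proof. by rewrite /outer_cell /= !in_diag_shape; lia. Qed.

Lemma count_staircase n c :
  count (fun r => c.+1 <= r) (mkseq (subn n) n) = n - c.
Proof.
elim: n => // n IHn; rewrite /mkseq /= -[1]/(1 + 0) iotaDl -map_comp.
by rewrite -/(mkseq (subn n) n) IHn; lia.
Qed.

(** From row 2 on the shape is a staircase, where arm and leg agree. *)
Lemma hook_shape a r c : in_diag (shape a) (r.+2, c) ->
  hook (shape a) (r.+2, c) = (2 * (a.+1 - r - c)).+1.
Proof.
rewrite in_diag_shape; case: c => [|c] => rc; first by lia.
rewrite /hook; cbn [fst snd predn]; rewrite nth_shapeS /shape.
by cbn [count]; rewrite count_staircase; lia.
Qed.

(** * Chains as complements of lattice paths *)

(* The chain [l] encodes the lattice path meeting row [r] in the columns from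
   [nth 0 l r.-1] to [nth 0 (a.+1 :: l) r.-1]; an excited diagram is the
   complement of such a path. *)
Definition off_path (a : nat) (l : seq nat) (p : nat * nat) : bool :=
  in_diag (shape a) p &&
  ~~ (nth 0 l p.1.-1 <= p.2 <= nth 0 (a.+1 :: l) p.1.-1).

Definition path_compl (a : nat) (l : seq nat) : {set cellT (shape a)} :=
  [set d | off_path a l (natc d)].

Lemma natc_inj M : injective (@natc M).
Proof. by case=> i j [i' j'] [/val_inj -> /val_inj ->]. Qed.

Lemma natc_surj a p : in_diag (shape a) p ->
  exists d : cellT (shape a), natc d = p.
Proof.
case: p => r c; rewrite in_diag_shape => rc.
have M : bnd (shape a) = (a + a + 4) by rewrite /bnd size_shape /=; lia.
have rM : r < bnd (shape a) by lia.
have cM : c < bnd (shape a) by lia.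
by exists (Ordinal rM, Ordinal cM).
Qed.

Lemma memc_path_compl a l p : memc (path_compl a l) p = off_path a l p.
Proof.
apply/existsP/idP => [[d /andP[]]|pl]; first by rewrite inE => + /eqP <-.
have [d dp] := natc_surj a p (proj1 (andP pl)).
by exists d; rewrite inE dp pl eqxx.
Qed.

(** At an index where one chain has the smaller entry, the cell of that row in that column lies on
    its path but to the left of the other path. *)
Lemma path_compl_inj a y y' l l' :
  l \in chains a.+1 y -> l' \in chains a.+1 y' ->
  path_compl a l = path_compl a l' -> l = l'.
Proof.
have wlog_le : forall y y' l l', l \in chains a.+1 y -> l' \in chains a.+1 y' ->
    path_compl a l = path_compl a l' ->
    forall k, k < a.+1 -> nth 0 l' k <= nth 0 l k.
  move=> {}y {}y' {}l {}l' /mem_chains[_ _ _ lP] /mem_chains[_ _ _ lP'] ll' k ka.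
  rewrite leqNgt; apply/negP => lk.
  have := memc_path_compl a l (k.+1, nth 0 l k).
  rewrite ll' memc_path_compl /off_path in_diag_shape.
  have := lP k ka; have := lP' k ka.
  case: k ka lk => [|k] ka lk /=; first by lia.
  by have := lP k (ltnW ka); lia.
move=> lc lc' ll'; have [sl _ ll _] := mem_chains _ _ _ lc.
have [sl' _ lll' _] := mem_chains _ _ _ lc'.
apply: (@eq_from_nth _ 0) => [|k]; rewrite sl ?sl' // ltnS leq_eqVlt.
case/predU1P => [->|ka]; first by rewrite ll lll'.
apply/eqP; rewrite eqn_leq (wlog_le y y' l l') //.
by rewrite (wlog_le y' y l' l).
Qed.

(** * Excited moves as unit decrements of one chain entry *)

(** Entry [k] is the left end of the path in row [k+1] and also its right end in row [k+2]. Lowering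
    it by one trades [(k+2, c+1)] for [(k+1, c)] on the path, which is an excited move of the
    complement. *)
Lemma off_path_set a y l k c p : l \in chains a.+1 y ->
  k < a.+1 -> nth 0 l k = c.+1 -> nth 0 l k.+1 <= c ->
  off_path a (set_nth 0 l k c) p =
  (p == (k.+2, c.+1)) || off_path a l p && (p != (k.+1, c)).
Proof.
case/mem_chains => [sl _ ll lP] ka lk lk1.
have := lP k ka; rewrite lk => ck; case: p => r d.
rewrite /off_path in_diag_shape !xpair_eqE.
case: r => [|[|r]]; cbn [fst snd predn].
- by lia.
- rewrite /= nth_set_nth /=; case: (eqVneq 0 k) => k0; last by lia.
  by subst k; move: lk lk1 ck (lP 0 ka); lia.
cbn [nth]; rewrite !nth_set_nth /=.
case: (eqVneq r.+1 k) => [rk|]; case: (eqVneq r k) => [rk'|]; subst; try lia.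
  by have := lP r (ltnW ka); lia.
Qed.

Lemma chain_set a y l k c : l \in chains a.+1 y ->
  k < a.+1 -> nth 0 l k = c.+1 -> 0 < nth 0 l k.+1 <= c ->
  exists y', set_nth 0 l k c \in chains a.+1 y'.
Proof.
case/mem_chains => [sl _ ll lP] ka lk lk1.
exists (nth 0 (set_nth 0 l k c) 0); apply/mem_chains; split=> //.
- by rewrite size_set_nth sl; lia.
- by rewrite nth_set_nth /= ifF //; lia.
move=> j ja; rewrite !nth_set_nth /=; have := lP j ja.
case: (eqVneq j k) => jk; case: (eqVneq j.+1 k) => j1k; try lia; subst; lia.
Qed.

Lemma exc_move_path_compl a y l (D : {set cellT (shape a)}) :
  l \in chains a.+1 y ->
  exc_move (path_compl a l) D ->
  exists k c, [/\ k < a.+1, nth 0 l k = c.+1, nth 0 l k.+1 <= c &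
    D = path_compl a (set_nth 0 l k c)].
Proof.
move=> lc /existsP[[r c] /andP[dl /and5P[]]].
rewrite !memc_path_compl /=; have [sl _ ll lP] := mem_chains _ _ _ lc.
move: dl; rewrite inE /off_path /natc /= !in_diag_shape.
case rE : (r : nat) => [|k]; first by lia.
move=> m1 m2 m3 m4 m5 /forallP DE; exists k, (nat_of_ord c).
have ka : k < a.+1 by lia.
(* The cell [(k+1, c)] is off the path while its right, lower and diagonal neighbours are on it, so
   the path leaves row [k+2] in column [c+1], having visited column [c]. *)
have lk : nth 0 l k = c.+1 /\ nth 0 l k.+1 <= c.
  by move: m1 m2 m3 m4 m5 (lP k ka) => /=; lia.
case: lk => lk lk1; split=> //; apply/setP => e; rewrite (eqP (DE e)).
rewrite !inE (off_path_set a y) // -(inj_eq (@natc_inj _)) /natc /= rE.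
by [].
Qed.

Lemma path_compl_exc_move a y l k c : l \in chains a.+1 y ->
  k < a.+1 -> nth 0 l k = c.+1 -> 0 < nth 0 l k.+1 <= c ->
  exc_move (path_compl a l) (path_compl a (set_nth 0 l k c)).
Proof.
move=> lc ka lk lk1; have [sl _ ll lP] := mem_chains _ _ _ lc.
have [d dE] : exists d : cellT (shape a), natc d = (k.+1, c).
  by apply: natc_surj; rewrite in_diag_shape; have := lP k ka; lia.
have [d1 d2] : val d.1 = k.+1 /\ val d.2 = c by case: dE.
apply/existsP; exists d; rewrite inE dE d1 d2 !memc_path_compl.
apply/andP; split; last apply/and5P; last split.
- by rewrite /off_path in_diag_shape; case: k {dE d1} ka lk lk1 => [|k] ka lk lk1 /=;
    have := lP _ ka; try have := lP _ (ltnW ka); lia.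
- by rewrite in_diag_shape; have := lP k ka; lia.
- rewrite /off_path in_diag_shape; case: k {dE d1} ka lk lk1 => [|k] ka lk lk1 /=;
    have := lP _ ka; try have := lP _ (ltnW ka); lia.
- by rewrite /off_path in_diag_shape /=; lia.
- by rewrite /off_path in_diag_shape /=; lia.
apply/forallP => e; rewrite !inE (off_path_set a y) //; last by lia.
by rewrite -dE (inj_eq (@natc_inj _)).
Qed.

(** * Excited diagrams are exactly the path complements *)

(** The path along the rim: each entry is as large as its row allows. The [maxn] only matters for
    the last entry, which must be 1 rather than 0. *)
Definition top_chain (a : nat) : seq nat :=
  mkseq (fun k => maxn 1 (a.+1 - k)) a.+2.

Lemma nth_top_chain a k : k < a.+2 -> nth 0 (top_chain a) k = maxn 1 (a.+1 - k).
Proof. by move=> ka; rewrite nth_mkseq. Qed.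

Lemma top_chain_mem a : top_chain a \in chains a.+1 a.+1.
Proof.
apply/mem_chains; split=> [|||k ka]; first by rewrite size_mkseq.
- by rewrite nth_top_chain; lia.
- by rewrite nth_top_chain; lia.
by rewrite !nth_top_chain; lia.
Qed.

Lemma diagT_path_compl a mu :
    (forall p, in_diag mu p =
       in_diag (shape a) p && ~~ outer_cell (shape a) p) ->
  diagT (shape a) mu = path_compl a (top_chain a).
Proof.
move=> muE; apply/setP => d; rewrite !inE muE; case: (natc d) => r c.
rewrite /off_path outer_cell_shape; case: (boolP (in_diag _ _)) => //=.
rewrite in_diag_shape; case: r => [|[|r]] rc; cbn [fst snd predn nth]; first by lia.
  by rewrite nth_top_chain; lia.
by rewrite !nth_top_chain; lia.
Qed.

(** Induction on the total deficit of the entries: unless the chain is [top_chain], some entry can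
    be raised, and undoing the raise is an excited move. *)
Lemma chain_connect a y l : l \in chains a.+1 y ->
  connect (@exc_move (shape a)) (path_compl a (top_chain a)) (path_compl a l).
Proof.
have [n] := ubnP (\sum_(k < a.+2) (a.+2 - nth 0 l k)).
elim: n y l => // n IHn y l ln lc; have [sl hl ll lP] := mem_chains _ _ _ lc.
have [/existsP ex|/existsPn full] :=
  boolP [exists k : 'I_a.+1, nth 0 l k < a.+1 - k]; last first.
  suff -> : l = top_chain a by exact: connect0.
  apply: (@eq_from_nth _ 0) => [|k]; rewrite sl ?size_mkseq // => ka.
  rewrite nth_top_chain //; move: ka; rewrite ltnS leq_eqVlt.
  case/predU1P => [->|ka]; first by rewrite ll; lia.
  by have := full (Ordinal ka); have := lP k ka; rewrite /=; lia.
have {ex} : exists k, nth 0 l k < a.+1 - k by case: ex => k; exists k.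
(* At the least non-maximal index any earlier entry is maximal, hence strictly larger, so raising
   entry [k] by one again gives a chain. *)
move=> ex; case: (ex_minnP ex) => k lk kmin {ex}.
have ka : k < a.+1 by lia.
pose l' := set_nth 0 l k (nth 0 l k).+1.
have l'k j : nth 0 l' j = if j == k then (nth 0 l k).+1 else nth 0 l j.
  by rewrite nth_set_nth.
have l'c : l' \in chains a.+1 (nth 0 l' 0).
  apply/mem_chains; split=> [||| j ja] //.
  - by rewrite size_set_nth sl; lia.
  - by rewrite l'k ifF //; lia.
  rewrite !l'k; have := lP j ja.
  case: (eqVneq j k) => jk; case: (eqVneq j.+1 k) => j1k; try lia.
    by subst; lia.
  by have := kmin j; subst k; lia.
have lE : l = set_nth 0 l' k (nth 0 l k).
  rewrite set_set_nth eqxx; apply: (@eq_from_nth _ 0) => [|j _].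
    by rewrite size_set_nth sl; lia.
  by rewrite nth_set_nth /=; case: eqP => [->|].
apply: (@connect_trans _ _ (path_compl a l')).
  apply: IHn l'c; rewrite ltnS in ln; apply: leq_trans ln.
  rewrite (bigD1 (Ordinal (leqW ka))) //= [X in _ < X](bigD1 (Ordinal (leqW ka))) //=.
  rewrite l'k eqxx -addSn leq_add //; first by lia.
  apply: leq_sum => j; rewrite -val_eqE /= l'k => jk; rewrite ifF //; lia.
apply: connect1; rewrite lE.
apply: (path_compl_exc_move a _ _ _ _ l'c) => //; first by rewrite l'k eqxx.
by rewrite l'k ifF; [have := lP k ka; lia | lia].
Qed.

Lemma mem_excited a mu D :
    (forall p, in_diag mu p =
       in_diag (shape a) p && ~~ outer_cell (shape a) p) ->
  D \in excited (shape a) mu <->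
  exists y, exists2 l, l \in chains a.+1 y & D = path_compl a l.
Proof.
move=> muE; rewrite inE (diagT_path_compl _ _ muE); split; last first.
  by case=> y [l lc ->]; exact: chain_connect _ _ _ lc.
case/connectP => p; have := top_chain_mem a.
move: {2}a.+1 (top_chain a) => y l lc.
elim: p y l lc => [|E p IHp] y l lc /=.
  by move=> _ ->; exists y, l.
case/andP => lE; have [k [c [ka lk lk1 EE]]] := exc_move_path_compl _ _ _ _ lc lE.
have [y' l'c] : exists y', set_nth 0 l k c \in chains a.+1 y'.
  apply: (chain_set _ y) => //; case/mem_chains: lc => _ _ _ /(_ k ka); lia.
by rewrite EE; exact: IHp l'c.
Qed.

(** * Naruse-Newton coefficients as chain sums *)

(** In row 1 the path covers the columns from [y] to [a+1]. *)
Lemma row1_count_path_compl a y l : l \in chains a.+1 y ->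
  (row1_count (path_compl a l)).+1 = y.
Proof.
move=> lc; have [sl hl _ lP] := mem_chains _ _ _ lc.
have y0 := lP 0 isT; rewrite hl in y0.
have M : bnd (shape a) = a + a + 4 by rewrite /bnd size_shape /=; lia.
have M1 : 1 < bnd (shape a) by lia.
rewrite /row1_count.
have -> : [set d in path_compl a l | val d.1 == 1] =
    setX [set Ordinal M1] [set j : 'I_(bnd (shape a)) | 0 < j < y].
  apply/setP => -[r c]; rewrite !inE /off_path /natc /= in_diag_shape.
  rewrite -val_eqE /=; case: (eqVneq (val r) 1) => [->|]; last by rewrite andbF.
  by rewrite /= hl; lia.
rewrite cardsX cards1 mul1n -sum1_card.
under eq_bigl => j do rewrite inE.
rewrite -(big_mkord (fun j => 0 < j < y) (fun=> 1)).
rewrite [LHS](_ : _ = (\sum_(1 <= j < y) 1).+1); last first.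
  rewrite (big_nat_widen 1 y (bnd (shape a))); last by lia.
  rewrite (big_nat_widenl 1 0) //; congr _.+1.
  by apply: eq_bigl => j; lia.
by rewrite sum_nat_const_nat muln1; lia.
Qed.

Lemma prod_hook_path_compl a y l : l \in chains a.+1 y ->
  \prod_(d in path_compl a l | val d.1 != 1) hook (shape a) (natc d) =
  chain_weight a.+1 l.
Proof.
move=> lc; have [sl hl _ lP] := mem_chains _ _ _ lc.
have M : bnd (shape a) = a + a + 4 by rewrite /bnd size_shape /=; lia.
pose P r c := off_path a l (r, c) && (r != 1).
transitivity (\prod_(i < bnd (shape a)) \prod_(j < bnd (shape a) | P i j)
    hook (shape a) (val i, val j)).
  rewrite pair_big_dep; apply: eq_bigl => -[i j].
  by rewrite inE.
pose G r := \prod_(j < bnd (shape a) | P r j) hook (shape a) (r, val j).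
(* Row 0 is outside the diagram and row 1 is excluded, so both give the factor 1, as do the rows
   beyond [a+2]. *)
rewrite -(big_mkord predT G) (big_cat_nat _ (n := 2)) //=.
rewrite [X in X * _](_ : _ = 1) ?mul1n; last first.
  rewrite !big_nat_recr ?big_geq //= /G !big1 // => j; rewrite /P ?andbF //.
rewrite (big_cat_nat _ (n := a.+3)) //=; try lia.
rewrite [X in _ * X](_ : _ = 1) ?muln1; last first.
  rewrite big_nat; apply: big1 => r ra; apply: big1 => j.
  by rewrite /P /off_path in_diag_shape; lia.
rewrite -[2]add0n big_addn subn2 /= big_mkord; apply: eq_bigr => k _.
have ka := ltn_ord k; have := lP k ka => lk.
rewrite /G /row_weight addn2 -(big_mkord (fun c => P k.+2 c)
  (fun c => hook (shape a) (k.+2, c))).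
rewrite (big_nat_widen 1 _ (bnd (shape a))); last by lia.
rewrite (big_nat_widenl 1 0) //.
have PE c : P k.+2 c = ((~~ (nth 0 l k.+1 <= c <= nth 0 l k) &&
    (c < (a.+1 - k).+1)) && (1 <= c)).
  by rewrite /P /off_path in_diag_shape /=; lia.
rewrite (eq_bigl _ _ PE); apply: eq_bigr => c; rewrite -PE /P => /andP[/andP[]].
by move=> /hook_shape -> _ _.
Qed.

Lemma sum_excited a mu i :
    (forall p, in_diag mu p =
       in_diag (shape a) p && ~~ outer_cell (shape a) p) ->
  \sum_(D in excited (shape a) mu | row1_count D == i)
    \prod_(d in D | val d.1 != 1) hook (shape a) (natc d) =
  chain_sum a.+1 i.+1.
Proof.
move=> muE; rewrite -big_filter.
rewrite (perm_big (map (path_compl a) (chains a.+1 i.+1))).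
  rewrite big_map; apply: eq_big_seq => l; exact: prod_hook_path_compl.
apply: uniq_perm => [||D].
- by rewrite filter_uniq // index_enum_uniq.
- rewrite map_inj_in_uniq; first exact: chains_uniq.
  by move=> l l'; exact: path_compl_inj.
rewrite mem_filter mem_index_enum andbT.
apply/andP/mapP => [[/(mem_excited _ _ _ muE)[y [l lc ->]]]|[l lc ->]].
  have rl := row1_count_path_compl _ _ _ lc.
  by move/eqP=> ri; exists l => //; rewrite -ri rl.
split; first by apply/(mem_excited _ _ _ muE); exists i.+1; exists l.
by rewrite -eqSS (row1_count_path_compl _ _ _ lc).
Qed.

(** * Identification of the partitions attached to [I_a] *)

Lemma mem_Iodd a i : (i \in Iodd a) = odd i && (i < 2 * a.+1).
Proof.
apply/mapP/andP => [[k + ->]|[oi ia]]; first by rewrite mem_iota => ka; lia.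
by exists i./2; rewrite ?mem_iota; lia.
Qed.

Lemma outer_cellE lam r c :
  in_diag lam (r, c) -> ~~ in_diag lam (r.+1, c.+1) -> outer_cell lam (r, c).
Proof. by rewrite /outer_cell /= => -> /negbTE ->; lia. Qed.

(** Column minus row grows by one at each step of a ribbon, which locates its two ends; the descents
    then fix all its cells, and these fix the partition. *)
Lemma is_lambdaI_unique a lam : is_lambdaI (Iodd a) lam -> lam = shape a.
Proof.
case=> /andP[/sortedP-/(_ 0) lam_le /allP lam_gt0].
case=> lam01 [s [[_ rib] [[I_lt I_below] outer]]].
set w := nth 0 lam 0 in lam01; set L := size lam.
have lamS k : nth 0 lam k.+1 <= nth 0 lam k.
  have [kL|Lk] := ltnP k.+1 L; first exact: lam_le.
  by rewrite nth_default.
have lamw k : nth 0 lam k <= w.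
  by elim: k => // k; apply: leq_trans.
have lam_pos k : k < L -> 0 < nth 0 lam k by move=> kL; exact/lam_gt0/mem_nth.
have diagE r c : in_diag lam (r, c) = (0 < r <= L) && (0 < c <= nth 0 lam r.-1) by [].
have s_diag k : k < size s -> in_diag lam (nth (0, 0) s k).
  by move=> ks; have /outer/andP[] := mem_nth (0, 0) ks.
have s_gt : 2 * a + 1 < size s.
  by have /andP[] : 0 < 2 * a + 1 < size s by apply: I_lt; rewrite mem_Iodd; lia.
have L0 : 0 < L.
  have := s_diag 0; case: (nth _ _ _) => r c; rewrite diagE => H.
  by have := H ltac:(lia); lia.
have w0 : 0 < w by exact: lam_pos.
have L1 : 1 < L by rewrite ltnNge; apply/negP => /(nth_default 0); rewrite -lam01; lia.
have content k : k < size s -> (nth (0, 0) s k).2 + (nth (0, 0) s 0).1 =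
    (nth (0, 0) s k).1 + (nth (0, 0) s 0).2 + k.
  elim: k => [|k IHk] ks; first by lia.
  by have [->|[]] := rib k ks => /=; have := IHk (ltnW ks); lia.
(* The cell [(L, 1)] has the least column minus row in the diagram; likewise [(1, w)] has the
   greatest, so it comes last. *)
have first_cell : nth (0, 0) s 0 = (L, 1).
  have /outer/(nthP (0, 0))[q qs qE] : outer_cell lam (L, 1).
    by apply: outer_cellE; rewrite diagE; have := lam_pos L.-1; lia.
  have := content q qs; have := s_diag 0; rewrite qE.
  case: (nth _ _ 0) => r c; rewrite diagE /= => H; have {H} := H ltac:(lia).
  by move=> H1 H2; congr (_, _); lia.
rewrite first_cell /= in content.
have [p ps pE] : exists2 p, p < size s & nth (0, 0) s p = (1, w).
  by apply/nthP/outer/outer_cellE; rewrite diagE /= -?lam01; lia.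
have [q qs qE] : exists2 q, q < size s & nth (0, 0) s q = (2, w).
  by apply/nthP/outer/outer_cellE; rewrite diagE /=; have := lamw 2; lia.
have p_last : (size s).-1 = p.
  have lt_last : (size s).-1 < size s by lia.
  have := content p ps; have := content _ lt_last; have := s_diag _ lt_last.
  case: (nth _ _ _) => r c; rewrite diagE pE /=; have := lamw r.-1; lia.
have qp : q = p.-1 by have := content p ps; have := content q qs; rewrite pE qE /=; lia.
(* As the first two rows have equal length, the last step goes up and [p] is a descent; with
   [2a+1 <= p] only [p = 2a+1] remains. *)
have size_s : size s = 2 * a.+1.
  suff : p \in Iodd a by rewrite mem_Iodd; lia.
  have p_rng : 0 < p < size s by lia.
  by apply: (proj2 (I_below p p_rng)); rewrite -qp pE qE.
(* With cells counted from 0, the step into cell [k] goes up exactly for odd [k]. *)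
have cellE k : k < size s -> (nth (0, 0) s k).1 + uphalf k = L /\
    (nth (0, 0) s k).2 = 1 + k./2.
  elim: k => [|k IHk] ks; first by rewrite first_cell addn0.
  have {IHk} [IH1 IH2] := IHk (ltnW ks).
  have /= below := I_below k.+1 ltac:(lia); rewrite mem_Iodd in below.
  have [ok|ek] := boolP (odd k.+1).
    by have [|] := proj1 below; [lia | move=> *; lia].
  have [->|[c1 c2]] /= := rib k ks; first by lia.
  by have := proj2 below (conj c1 (esym c2)); lia.
have := cellE p ps; rewrite pE /= => -[Lp wp].
apply: (@eq_from_nth _ 0) => [|k kL]; first by rewrite size_shape -/L; lia.
case: k kL => [|k] kL; first by rewrite -/w /=; lia.
rewrite nth_shapeS.
have [j js jE] : exists2 j, j < size s & nth (0, 0) s j = (k.+2, nth 0 lam k.+1).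
  apply/nthP/outer/outer_cellE; rewrite diagE /=.
    by have := lam_pos k.+1 kL; lia.
  by have := lamS k.+1; lia.
have := cellE j js; rewrite jE /=.
(* The row of cell [j] forces [j] to be [2(a-k)] or its predecessor. Cell [2(a-k)] lies in the same
   row of the diagram, so the end of that row is in its column. *)
have := s_diag (2 * (a - k)); have := cellE (2 * (a - k)).
case: (nth _ _ _) => r c; rewrite diagE /=.
move=> H1 H2; have {H1} [H1 H1'] := H1 ltac:(lia); have {H2} := H2 ltac:(lia).
have -> : r.-1 = k.+1 by lia.
lia.
Qed.

Definition rim (a : nat) : seq (nat * nat) :=
  mkseq (fun k => (a.+2 - uphalf k, 1 + k./2)) (2 * a.+1).

Lemma is_lambdaI_shape a : is_lambdaI (Iodd a) (shape a).
Proof.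
split; last split; first apply/andP; first split.
- apply/(sortedP 0) => -[|k]; rewrite size_shape !nth_shapeS /=; lia.
- apply/(all_nthP 0) => -[|k]; rewrite size_shape ?nth_shapeS /=; lia.
- by rewrite nth_shapeS /= subn0.
have size_rim : size (rim a) = 2 * a.+1 by rewrite size_mkseq.
have nth_rim k : k < 2 * a.+1 ->
    nth (0, 0) (rim a) k = (a.+2 - uphalf k, 1 + k./2).
  by move=> ka; rewrite nth_mkseq.
exists (rim a); split; last split; first split; last 1 first.
- case=> r c; rewrite outer_cell_shape in_diag_shape; split=> [rc|].
    have [k ka kE] : exists2 k, k < 2 * a.+1 & r = a.+2 - uphalf k /\ c = 1 + k./2.
      (* The index of a rim cell is its column minus row, counted from the value at the first cell
         [(a+2, 1)]. *)
      have [r1|r1] := eqVneq r 1; first by exists (2 * a).+1; lia.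
      by exists (a + 1 + c - r); lia.
    case: kE => -> ->; rewrite -nth_rim //; by apply: mem_nth; rewrite size_rim.
  by case/(nthP (0, 0)) => k; rewrite size_rim => ka; rewrite nth_rim // => -[<- <-]; lia.
- rewrite map_inj_in_uniq ?iota_uniq // => j k; rewrite !mem_iota => jk kk [].
  by lia.
- move=> k; rewrite size_rim => ka; rewrite !nth_rim; [|lia..].
  have [ok|ek] := boolP (odd k); last by right=> /=; lia.
  by left; congr (_, _) => /=; lia.
- split=> i; rewrite size_rim mem_Iodd; first by lia.
  move=> ia; rewrite !nth_rim; try lia; rewrite /directly_below /=.
  by split=> H; lia.
Qed.

Lemma lambdaI_Iodd a : lambdaI (Iodd a) = shape a.
Proof.
apply: is_lambdaI_unique; apply: epsilon_spec.
by exists (shape a); exact: is_lambdaI_shape.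
Qed.

Lemma in_diag_muI a p : in_diag (muI (Iodd a)) p =
  in_diag (shape a) p && ~~ outer_cell (shape a) p.
Proof.
have [_ []] : is_muI (Iodd a) (muI (Iodd a)); last first.
  by rewrite lambdaI_Iodd => /(_ p) sub /(_ p) <-; move: sub;
    case: (in_diag _ p) (in_diag _ p) => -[] //= /(_ isT).
(* Removing the rim leaves the staircase [(a, a-1, ..., 1)]. *)
apply: epsilon_spec; exists (mkseq (subn a) a); rewrite /is_muI lambdaI_Iodd.
have diagE r c : in_diag (mkseq (subn a) a) (r, c) =
    [&& 0 < r, 0 < c & r + c <= a.+1].
  rewrite /in_diag size_mkseq; case: r => // r /=.
  by have [ra|ra] := ltnP r a; [rewrite nth_mkseq | ]; lia.
split; last split.
- apply/andP; split.
    by apply/(sortedP 0) => k; rewrite size_mkseq => ka; rewrite !nth_mkseq /=; lia.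
  by apply/(all_nthP 0) => k; rewrite size_mkseq => ka; rewrite nth_mkseq; lia.
- by case=> r c; rewrite diagE in_diag_shape; lia.
by case=> r c; rewrite outer_cell_shape diagE in_diag_shape; lia.
Qed.

(** Since [s = a], the diagrams counted have [a - (a - i) = i] cells in row 1, so their chains start
    with [i+1]. *)
Lemma NNcoef_Iodd i a : i <= a -> NNcoef (a - i) (Iodd a) = chain_sum a.+1 i.+1.
Proof.
move=> ia; have sE : sI (Iodd a) = a by rewrite /sI lambdaI_Iodd.
rewrite /NNcoef sE subKn // -(sum_excited _ _ _ (in_diag_muI a)).
by rewrite lambdaI_Iodd.
Qed.

(** * Polynomial solution of the difference equation *)

Local Open Scope ring_scope.
(** This is [2^j] times the falling factorial of [t + 1/2] of length [j]. *)
Definition odd_falling (j : nat) : {poly rat} :=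
  \prod_(l < j) (2%:R *: 'X + (1 - 2%:R * l%:R)%:P).

Lemma horner_odd_falling j x :
  (odd_falling j).[x] = \prod_(l < j) (2%:R * x + 1 - 2%:R * l%:R).
Proof.
rewrite horner_prod; apply: eq_bigr => l _.
by rewrite !hornerE /=; ring.
Qed.

Lemma size_odd_falling j : (size (odd_falling j) <= j.+1)%N.
Proof.
elim: j => [|j IHj]; first by rewrite /odd_falling big_ord0 size_poly1.
rewrite /odd_falling big_ord_recr -/(odd_falling j).
apply: leq_trans (size_polyMleq _ _) _.
have size2 : (size ((2%:R : rat) *: 'X + (1 - 2%:R * j%:R)%:P)%R <= 2)%N.
  rewrite (leq_trans (size_polyD _ _)) // geq_max.
  by rewrite (leq_trans (size_scale_leq _ _)) ?size_polyX // (leq_trans (size_polyC_leq1 _)).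
by rewrite -subn1 leq_subLR (leq_trans (leq_add IHj size2)) // addn2.
Qed.

(** Both sides are the product of the [j+1] factors [2x+3, 2x+1, ..., 2x+3-2j]. *)
Lemma horner_odd_fallingD1 j x :
  (2%:R * x + 3%:R - 2%:R * j%:R) * (odd_falling j).[x + 1] =
  (2%:R * x + 3%:R) * (odd_falling j).[x].
Proof.
rewrite !horner_odd_falling mulrC.
have -> : \prod_(l < j) (2%:R * (x + 1) + 1 - 2%:R * l%:R) *
    (2%:R * x + 3%:R - 2%:R * j%:R) =
    \prod_(l < j.+1) (2%:R * (x + 1) + 1 - 2%:R * l%:R).
  by rewrite big_ord_recr /=; congr (_ * _); ring.
rewrite big_ord_recl /=; congr (_ * _); first by ring.
by apply: eq_bigr => l _; rewrite /bump /= natrD; ring.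
Qed.

Lemma odd_falling_neq0 i : (odd_falling i.+1).[i%:R] != 0.
Proof.
rewrite horner_odd_falling; apply/prodf_neq0 => l _.
have -> : 2%:R * i%:R + 1 - 2%:R * l%:R = (2 * (i - l) + 1)%:R :> rat.
  by rewrite natrD natrM natrB ?leq_ord //; ring.
by rewrite pnatr_eq0 addn1.
Qed.

(* The difference operator of the recurrence maps [odd_falling j] to
   [2 (j - i - 1)] times its shift by 1; only [j = i + 1] is degenerate, and
   that coefficient is fixed by [R i.+1 i = 0]. *)
Lemma polynomial_solution (R : nat -> nat -> rat) :
    (forall a, R 0 a = 1) -> (forall i, R i.+1 i = 0) ->
    (forall i a, (i <= a)%N ->
       (2 * (a - i) + 1)%:R * R i.+1 a.+1 =
       R i a.+1 + (2%:R * a%:R + 3%:R) * R i.+1 a) ->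
  forall i, exists c : nat -> rat, forall a, (i <= a.+1)%N ->
    (\sum_(j < i.+1) c j *: odd_falling j).[a%:R] = R i a.
Proof.
move=> R0 Rdiag Rrec; elim=> [|i [c cP]].
  exists (fun j => (j == 0)%:R) => a _.
  by rewrite big_ord1 /= scale1r horner_odd_falling big_ord0 R0.
(* Coefficients of a particular solution [E]; the divisor is nonzero for [j <= i]. *)
pose e j := c j / (2%:R * j%:R - 2%:R * i%:R - 2%:R).
pose E x := (\sum_(j < i.+1) e j *: odd_falling j).[x].
(* The multiple of the homogeneous solution that makes the value at [i] vanish. *)
pose k := - E i%:R / (odd_falling i.+1).[i%:R].
exists (fun j => if (j <= i)%N then e j else k).
have EP x : (\sum_(j < i.+2) (if (j <= i)%N then e j else k) *: odd_falling j).[x] =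
    E x + k * (odd_falling i.+1).[x].
  rewrite big_ord_recr /= ltnn hornerD hornerZ; congr (_ + _).
  by rewrite /E; congr (_.[x]); apply: eq_bigr => j _; rewrite leq_ord.
have Erec x : (2%:R * x + 1 - 2%:R * i%:R) * E (x + 1) =
    (\sum_(j < i.+1) c j *: odd_falling j).[x + 1] +
    (2%:R * x + 3%:R) * E x.
  rewrite /E !horner_sum !mulr_sumr -big_split /=; apply: eq_bigr => j _.
  rewrite !hornerZ; have := horner_odd_fallingD1 j x.
  set u := _.[_]; set v := _.[x] => uv.
  have ne0 : 2%:R * (j : nat)%:R - 2%:R * i%:R - 2%:R != 0 :> rat.
    have -> : 2%:R * (j : nat)%:R - 2%:R * i%:R - 2%:R =
        - (2 * (i - j) + 2)%:R :> rat.
      by rewrite natrD natrM natrB ?leq_ord //; ring.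
    by rewrite oppr_eq0 pnatr_eq0 addn2.
  rewrite mulrCA [_ * (e j * v)]mulrCA -uv /e; field.
  by move: ne0; rewrite -!natrM.
have E0 : E i%:R + k * (odd_falling i.+1).[i%:R] = 0.
  by rewrite /k mulfVK ?odd_falling_neq0 // subrr.
(* Both sides agree at [a = i] and satisfy the same recurrence, whose leading coefficient [2d+1]
   never vanishes. *)
move=> a; rewrite ltnS => /subnKC <-; elim: (a - i)%N => [|d IHd].
  by rewrite addn0 EP Rdiag.
have := Rrec i (i + d)%N (leq_addr _ _); rewrite -IHd -cP; last by lia.
rewrite !EP [(i + d.+1)%N]addnS -[(i + d).+1%:R]natr1 addKn.
have := horner_odd_fallingD1 i.+1 (i + d)%:R; have := Erec (i + d)%:R.
set u := E _; set v := E _; set w := _.[_ + 1]; set x := _.[_ + 1].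
set y := _.[_] => uv xy wP.
apply: (@mulfI _ (2 * d + 1)%:R); first by rewrite pnatr_eq0 addn1.
rewrite {}wP [(2 * d + 1)%:R]natrD [(2 * d)%:R]natrM.
rewrite -[i.+1%:R]natr1 !(natrD _ i d) in uv xy *.
have -> : (2 * d%:R + 1) * (u + k * x) =
    (2 * (i%:R + d%:R) + 1 - 2 * i%:R) * u +
    k * ((2 * (i%:R + d%:R) + 3 - 2 * (i%:R + 1)) * x) by ring.
by rewrite uv xy; ring.
Qed.

(** * Uniqueness by counting roots *)

(** A nonzero difference would have size at most [n] and the [n] distinct roots [m, ..., m+n-1]. *)
Lemma poly_eq_of_large_nat (n m : nat) (p q : {poly rat}) :
    (size p <= n)%N -> (size q <= n)%N ->
    (forall a : nat, (m <= a)%N -> p.[a%:R] = q.[a%:R]) ->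
  p = q.
Proof.
move=> sp sq pq; apply/eqP; rewrite -subr_eq0; apply/negPn/negP => pq0.
pose rs := [seq (k%:R : rat) | k <- iota m n].
have rs_root : all (root (p - q)) rs.
  apply/allP => x /mapP[k]; rewrite mem_iota => /andP[mk _] ->.
  by rewrite rootE !hornerE pq // subrr.
have rs_uniq : uniq rs.
  by rewrite map_inj_uniq ?iota_uniq // => x y /eqP; rewrite eqr_nat => /eqP.
have := max_poly_roots pq0 rs_root rs_uniq; rewrite size_map size_iota ltnNge.
by rewrite (leq_trans (size_polyD _ _)) // size_polyN geq_max sp sq.
Qed.

(** * Recurrence for the coefficient ratios, and conclusion *)

Definition chain_ratio (i a : nat) : rat :=
  (chain_sum a.+1 i.+1)%:R / (chain_sum a.+1 1)%:R.

(** The case [y = 0] of [chain_sum_recr] reads [(2a+3) C_(a+1) = w C_a] with [w] the full row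
    product; it eliminates [w] from the case [y = i+1]. *)
Lemma chain_ratio_recr i a : (i <= a)%N ->
  (2 * (a - i) + 1)%:R * chain_ratio i.+1 a.+1 =
  chain_ratio i a.+1 + (2%:R * a%:R + 3%:R) * chain_ratio i.+1 a.
Proof.
move=> ia; have ne0 m : (chain_sum m 1)%:R != 0 :> rat.
  by rewrite pnatr_eq0 -lt0n chain_sum1_gt0.
have : (chain_sum a.+2 i.+2 * (2 * (a - i)).+1)%:R =
    (chain_sum a.+2 i.+1 + chain_sum a.+1 i.+2 * row_weight a.+2 1 0)%:R :> rat.
  by have := chain_sum_recr a.+1 i.+1 ia; rewrite subSS => ->.
have : (chain_sum a.+2 1 * (2 * a + 3))%:R =
    (chain_sum a.+1 1 * row_weight a.+2 1 0)%:R :> rat.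
  have := chain_sum_recr a.+1 0 isT; rewrite subn0 chain_sum0 add0n => <-.
  by congr (_ * _)%:R; lia.
have -> : 2%:R * a%:R + 3%:R = (2 * a + 3)%:R :> rat by rewrite natrD natrM.
have := ne0 a.+1; have := ne0 a.+2; rewrite /chain_ratio -[X in (X)%:R * _]/(_ + 1)%N addn1.
rewrite natrD !natrM; set b := (2 * a + 3)%:R; set h := (_.+1)%:R.
set A := (chain_sum a.+2 1)%:R; set B := (chain_sum a.+1 1)%:R.
set w := (row_weight _ _ _)%:R; set x := (chain_sum a.+2 i.+2)%:R.
set y := (chain_sum a.+2 i.+1)%:R; set z := (chain_sum a.+1 i.+2)%:R.
move=> A0 B0 Aw.
have -> : w = A * b / B by rewrite Aw mulrAC mulfV ?mul1r.
by move=> xw; rewrite mulrA [h * x]mulrC xw; field; rewrite A0 B0.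
Qed.

Theorem theorem7p4 (i : nat) :
  exists! P : {poly rat},
    (size P <= i.+1)%N /\
    forall a : nat, (i <= a)%N ->
      P.[a%:R] = (NNcoef (a - i) (Iodd a))%:R / (NNcoef a (Iodd a))%:R.
Proof.
have ratioE a : (i <= a)%N ->
    (NNcoef (a - i) (Iodd a))%:R / (NNcoef a (Iodd a))%:R = chain_ratio i a.
  move=> ia; have := NNcoef_Iodd 0 a isT; rewrite subn0 => ->.
  by rewrite NNcoef_Iodd.
have ratio0 a : chain_ratio 0 a = 1.
  by rewrite /chain_ratio mulfV // pnatr_eq0 -lt0n chain_sum1_gt0.
(* A first entry [j+2] exceeds the row length [j+1], so there is no chain; this supplies the initial
   value. *)
have ratio_diag j : chain_ratio j.+1 j = 0.
  by rewrite /chain_ratio chain_sum_gt ?mul0r // gtn_max; lia.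
have [c cP] := polynomial_solution chain_ratio ratio0 ratio_diag chain_ratio_recr i.
pose P := \sum_(j < i.+1) c j *: odd_falling j.
have sP : (size P <= i.+1)%N.
  apply: (leq_trans (size_sum _ _ _)); apply/bigmax_leqP => j _.
  apply: leq_trans (size_scale_leq _ _) _.
  by rewrite (leq_trans (size_odd_falling j)).
exists P; split=> [|Q [sQ QE]].
  by split=> // a ia; rewrite ratioE // cP // leqW.
apply: (poly_eq_of_large_nat i.+1 i) => // a ia.
by rewrite cP ?leqW // QE // ratioE.
Qed.
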